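(* Let $\ell\in\{\tfrac12,\tfrac32,\tfrac52,\dots\}$, let $\delta,\mu$ be fixed real numbers, and let $m\ge1$ be an integer. In order for the vector $$|u_m\rangle=\sum_{h,\mathbf{k}}a(h,\mathbf{k})\,|h,\mathbf{k};m\rangle\in V^{\delta,\mu}_m$$ to be a singular vector, $m$ must be even, in which case the coefficients $a(h,\mathbf{k})$ are unique up to an overall factor.
   Context: For $\ell\in\{\tfrac12,\tfrac32,\tfrac52,\dots\}$, $\mathfrak{g}_\ell$ is the Lie algebra (centrally extended conformal Galilei algebra in one spatial dimension) with basis $C,D,H,M,P_0,P_1,\dots,P_{2\ell}$, where $M$ is central and the other non-zero brackets are $[D,H]=2H$, $[D,C]=-2C$, $[C,H]=D$, $[H,P_n]=-nP_{n-1}$, $[D,P_n]=2(\ell-n)P_n$, $[C,P_n]=(2\ell-n)P_{n+1}$, $[P_m,P_n]=\delta_{m+n,2\ell}\,I_m M$ with $I_m=(-1)^{m+\ell+\frac12}\,m!\,(2\ell-m)!$. Triangular decomposition: $\mathfrak{g}_\ell^+=\mathrm{span}\{H,P_0,\dots,P_{\ell-\frac12}\}$, $\mathfrak{g}_\ell^0=\mathrm{span}\{D,M\}$, $\mathfrak{g}_\ell^-=\mathrm{span}\{C,P_{\ell+\frac12},\dots,P_{2\ell}\}$. For fixed real $\delta,\mu$, the Verma module $V^{\delta,\mu}=U(\mathfrak{g}_\ell^-)|\delta,\mu\rangle$ is generated by the highest weight vector $|\delta,\mu\rangle$ with $D|\delta,\mu\rangle=\delta|\delta,\mu\rangle$,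 $M|\delta,\mu\rangle=\mu|\delta,\mu\rangle$, $X|\delta,\mu\rangle=0$ for all $X\in\mathfrak{g}_\ell^+$. Its level-$m$ subspace $V^{\delta,\mu}_m$ has basis the vectors $|h,\mathbf{k};m\rangle=C^h\prod_{j=0}^{\ell-\frac12}P_{\ell+\frac12+j}^{k_j}|\delta,\mu\rangle$, where $h\in\mathbb{Z}_{\ge0}$, $\mathbf{k}=(k_1,\dots,k_{\ell-\frac12})\in\mathbb{Z}_{\ge0}^{\ell-\frac12}$ and $k_0=m-2h-\sum_{j=1}^{\ell-\frac12}(2j+1)k_j\ge0$; the sum over $h,\mathbf{k}$ runs over all such labels. A singular vector at level $m$ is a nonzero $u\in V^{\delta,\mu}_m$ with $Xu=0$ for all $X\in\mathfrak{g}_\ell^+$; the vector $|\delta,\mu\rangle$ at level $0$ is not considered to be a singular vector.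
   Formalization: The formal theorem assumes μ ≠ 0; for μ = 0 the claim is false for every ℓ and δ, since P_{ℓ+1/2}|δ,0⟩ is then a singular vector at the odd level m = 1. *)

(* Defs.v *)
From HB Require Import structures.
From mathcomp Require Import all_boot all_order all_algebra.
From mathcomp Require Import reals.

Set Implicit Arguments.
Unset Strict Implicit.
Unset Printing Implicit Defensive.

Import Order.TTheory GRing.Theory Num.Theory.
Local Open Scope ring_scope.

(* The half-integer l is encoded by p : nat with l = p + 1/2, so that
   2l = 2p + 1, l - 1/2 = p and l + 1/2 = p + 1.                              *)

Inductive gen (p : nat) := gC | gD | gH | gM | gP of 'I_(2 * p).+2.

Arguments gC {p}.
Arguments gD {p}.
Arguments gH {p}.
Arguments gM {p}.

Definition gen_code p (g : gen p) : 'I_4 + 'I_(2 * p).+2 :=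
  match g with
  | gC => inl (inord 0) | gD => inl (inord 1)
  | gH => inl (inord 2) | gM => inl (inord 3)
  | gP n => inr n
  end.

Definition gen_decode p (c : 'I_4 + 'I_(2 * p).+2) : gen p :=
  match c with
  | inl i => nth gC [:: gC; gD; gH; gM] i
  | inr n => gP n
  end.

Lemma gen_codeK p : cancel (@gen_code p) (@gen_decode p).
Proof. by case=> //=; rewrite inordK. Qed.

HB.instance Definition _ p := Finite.copy (gen p) (can_type (@gen_codeK p)).

Section Algebra.
Variables (p : nat) (R : realType).

(* Carrier of the Lie algebra g_l: the real vector space with basis gen p.    *)
Definition cga := {ffun gen p -> R^o}.

Definition elt (g : gen p) : cga := [ffun x => (x == g)%:R].

(* P_n for n <= 2l = 2p+1; for larger n the value is a dummy, which occurs
   below only with coefficient 0.                                             *)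
Definition P_ (n : nat) : cga := elt (gP (inord n)).

Definition I_ (m : nat) : R :=
  (-1) ^+ (m + p + 1) * (m`!)%:R * ((2 * p + 1 - m)`!)%:R.

Definition bracket_gen (x y : gen p) : cga :=
  match x, y with
  | gD, gH => 2 *: elt gH
  | gH, gD => - (2 *: elt gH)
  | gD, gC => - (2 *: elt gC)
  | gC, gD => 2 *: elt gC
  | gC, gH => elt gD
  | gH, gC => - elt gD
  | gH, gP n => - (n%:R *: P_ n.-1)
  | gP n, gH => n%:R *: P_ n.-1
  | gD, gP n => ((2 * p + 1)%:R - (2 * n)%:R) *: P_ n
  | gP n, gD => - (((2 * p + 1)%:R - (2 * n)%:R) *: P_ n)
  | gC, gP n => ((2 * p + 1)%:R - n%:R) *: P_ n.+1
  | gP n, gC => - (((2 * p + 1)%:R - n%:R) *: P_ n.+1)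
  | gP m, gP n => if (m + n == 2 * p + 1)%N then I_ m *: elt gM else 0
  | _, _ => 0
  end.

Definition bracket (x y : cga) : cga :=
  \sum_(g : gen p) \sum_(g' : gen p) (x g * y g') *: bracket_gen g g'.

Definition g_plus : {vspace cga} :=
  <<elt gH :: [seq P_ n | n <- iota 0 p.+1]>>%VS.

Section Module.
Variables (V : lmodType R) (rho : cga -> V -> V).

Definition is_representation :=
  [/\ forall x, linear (rho x), forall v, linear (rho^~ v) &
      forall x y v, rho (bracket x y) v = rho x (rho y v) - rho y (rho x v)].

Definition is_highest_weight (delta mu : R) (v0 : V) :=
  [/\ rho (elt gD) v0 = delta *: v0, rho (elt gM) v0 = mu *: v0 &
      forall X, X \in g_plus -> rho X v0 = 0].

Variable v0 : V.

(* C^h P_(l+1/2)^(k 0) P_(l+3/2)^(k 1) ... P_(2l)^(k p) v0                    *)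
Definition monomial (h : nat) (k : 'I_p.+1 -> nat) : V :=
  iter h (rho (elt gC))
    (foldr (fun j : 'I_p.+1 => iter (k j) (rho (P_ (p + 1 + j)))) v0
           (enum 'I_p.+1)).

Definition pbw (i : nat * {ffun 'I_p.+1 -> nat}) : V := monomial i.1 i.2.

(* V is U(g^-) v0 and free of rank one over U(g^-), expressed through the
   Poincare-Birkhoff-Witt basis of U(g^-), where
   g^- = span {C, P_(l+1/2), ..., P_(2l)}. If mu = 0, then P_(l+1/2) v0 is a
   nonzero vector of level 1 annihilated by g^+, so that the parity of the
   level of a singular vector is only constrained when mu != 0.               *)
Definition is_verma (delta mu : R) :=
  [/\ is_representation,
      is_highest_weight delta mu v0,
      forall v, exists (s : seq (nat * {ffun 'I_p.+1 -> nat})) c,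
        v = \sum_(i <- s) c i *: pbw i &
      forall (s : seq (nat * {ffun 'I_p.+1 -> nat})) (c : _ -> R), uniq s ->
        \sum_(i <- s) c i *: pbw i = 0 -> forall i, i \in s -> c i = 0].

Variable m : nat.

(* Level of C^h prod_(j = 1)^p P_(l+1/2+j)^(k_j), where k_j is k at the
   ordinal j - 1, hence the weight 2j + 1 = 2i + 3.                           *)
Definition partial_level (h : nat) (k : 'I_p -> nat) : nat :=
  (2 * h + \sum_(i < p) (2 * i + 3) * k i)%N.

(* Labels (h, (k_1, ..., k_p)) at level m, i.e. those with k_0 >= 0. The
   bounds h <= m and k_j <= m exclude no label; they make the type finite.    *)
Definition label :=
  {x : 'I_m.+1 * {ffun 'I_p -> 'I_m.+1} |
    (partial_level x.1 (fun i => x.2 i) <= m)%N}.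

Definition full_exponents (x : label) (j : 'I_p.+1) : nat :=
  match unlift ord0 j with
  | Some i => (val x).2 i
  | None => m - partial_level (val x).1 (fun i => (val x).2 i)
  end.

Definition ket (x : label) : V := monomial (val x).1 (full_exponents x).

Definition ket_sum (a : label -> R) : V := \sum_(x : label) a x *: ket x.

Definition in_level (u : V) := exists a, u = ket_sum a.

Definition is_singular (u : V) :=
  [/\ in_level u, u != 0 & forall X, X \in g_plus -> rho X u = 0].

End Module.
End Algebra.

(* Main.v *)
Require Import Defs.
From mathcomp Require Import all_boot all_order all_algebra.
From mathcomp Require Import reals.
From mathcomp Require Import zify.

(** Only the annihilation by [P_0, ..., P_(l-1/2)] is needed. Filter [V] by the
    power of [C]. Commuting [P_n] through [C^h] only creates terms with fewer
    factors [C], and [P_n] acts on [prod_j P_(l+1/2+j)^(k_j) v0] as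
    [I_n mu] times the partial derivative in [P_(2l-n)]. Hence, as [mu != 0],
    the part of highest degree in [C] of a singular vector is constant in the
    [P]'s: it is a multiple of [C^h v0], so that [m = 2h]. Two singular vectors
    of level [m] thus have a linear combination, annihilated by the same [P_n],
    in which the coefficient of [C^h v0] vanishes, and which must then be [0]. *)

Import Order.TTheory GRing.Theory Num.Theory.
Local Open Scope ring_scope.

(** * Brackets of the basis elements used in the proof *)

Section LieAlgebra.
Set Implicit Arguments.
Unset Strict Implicit.
Variables (p : nat) (R : realType).

Lemma bracket_elt (x y : gen p) :
  bracket (elt R x) (elt R y) = bracket_gen R x y.
Proof.
rewrite /bracket (bigD1 x) //= (bigD1 y) //= !ffunE !eqxx mulr1 scale1r.
rewrite big1 ?addr0 => [|g' /negbTE g'y]; last first.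
  by rewrite !ffunE g'y mulr0 scale0r.
rewrite big1 ?addr0 // => g /negbTE gx.
by rewrite big1 // => g' _; rewrite !ffunE gx mul0r scale0r.
Qed.

Lemma bracket_PP (a b : nat) : (a < (2 * p).+2)%N -> (b < (2 * p).+2)%N ->
  bracket (P_ p R a) (P_ p R b) =
  if (a + b == 2 * p + 1)%N then I_ p R a *: elt R gM else 0.
Proof. by move=> ha hb; rewrite bracket_elt /= !inordK. Qed.

Lemma bracket_CP (n : nat) : (n < (2 * p).+2)%N ->
  bracket (elt R gC) (P_ p R n) = ((2 * p + 1)%:R - n%:R) *: P_ p R n.+1.
Proof. by move=> hn; rewrite bracket_elt /= inordK. Qed.

Lemma bracket_MP (n : nat) : bracket (elt R gM) (P_ p R n) = 0.
Proof. by rewrite bracket_elt. Qed.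

Lemma I_neq0 (n : nat) : I_ p R n != 0.
Proof.
by rewrite /I_ !mulf_neq0 ?expf_neq0 ?oppr_eq0 ?oner_eq0 ?pnatr_eq0 -?lt0n ?fact_gt0.
Qed.

Lemma P_in_g_plus (n : nat) : (n <= p)%N -> P_ p R n \in g_plus p R.
Proof.
move=> np; apply: memv_span; rewrite inE; apply/orP; right.
by apply/mapP; exists n; rewrite // mem_iota.
Qed.

End LieAlgebra.

(** * Linearity of the action and commutation rules on the module *)

Section Verma.
Set Implicit Arguments.
Unset Strict Implicit.
Variables (p : nat) (R : realType) (delta mu : R).
Variables (V : lmodType R) (rho : cga p R -> V -> V) (v0 : V).
Hypothesis verma : is_verma rho v0 delta mu.

Let P n := rho (P_ p R n).
Let C := rho (elt R gC).
Let M := rho (elt R gM).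

Lemma rhoP x c u v : rho x (c *: u + v) = c *: rho x u + rho x v.
Proof. by case: verma => -[lin _ _] _ _ _; rewrite lin. Qed.

Lemma rhoD x u v : rho x (u + v) = rho x u + rho x v.
Proof. by rewrite -[u]scale1r rhoP !scale1r. Qed.

Lemma rho0 x : rho x 0 = 0.
Proof. by apply: (addrI (rho x 0)); rewrite -rhoD !addr0. Qed.

Lemma rhoZ x c u : rho x (c *: u) = c *: rho x u.
Proof. by rewrite -[c *: u]addr0 rhoP rho0 addr0. Qed.

Lemma rhoB x u v : rho x (u - v) = rho x u - rho x v.
Proof. by rewrite -scaleN1r addrC rhoP scaleN1r addrC. Qed.

Lemma rho_sum x (I : Type) (s : seq I) (Q : pred I) (F : I -> V) :
  rho x (\sum_(i <- s | Q i) F i) = \sum_(i <- s | Q i) rho x (F i).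
Proof. exact: (big_morph _ (rhoD x) (rho0 x)). Qed.

Lemma rho_scalel c x v : rho (c *: x) v = c *: rho x v.
Proof.
case: verma => -[_ lin _] _ _ _.
have rho0l : rho 0 v = 0.
  have := lin v 1 0 0; rewrite !scale1r addr0 => /eqP.
  by rewrite eq_sym -subr_eq0 addrK => /eqP.
by rewrite -[c *: x]addr0 lin rho0l addr0.
Qed.

Lemma rho0l v : rho 0 v = 0.
Proof. by rewrite -[0](scale0r (0 : cga p R)) rho_scalel scale0r. Qed.

Lemma rho_commute x y v : rho x (rho y v) = rho y (rho x v) + rho (bracket x y) v.
Proof. by case: verma => -[_ _ ->] _ _ _; rewrite addrC subrK. Qed.

Lemma PP (a b : nat) v : (a < (2 * p).+2)%N -> (b < (2 * p).+2)%N ->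
  P a (P b v) =
  P b (P a v) + (if (a + b == 2 * p + 1)%N then I_ p R a *: M v else 0).
Proof.
move=> ha hb; rewrite /P rho_commute bracket_PP //.
by case: ifP => _; rewrite ?rho0l ?rho_scalel.
Qed.

Lemma PC (n : nat) v : (n < (2 * p).+2)%N ->
  P n (C v) = C (P n v) - ((2 * p + 1)%:R - n%:R) *: P n.+1 v.
Proof.
by move=> hn; rewrite [C (P n v)]rho_commute bracket_CP // rho_scalel addrK.
Qed.

Lemma MP (n : nat) v : M (P n v) = P n (M v).
Proof. by rewrite /M /P rho_commute bracket_MP rho0l addr0. Qed.

Lemma iterC0 h : iter h C 0 = 0.
Proof. by elim: h => //= h ->; rewrite /C rho0. Qed.

Lemma iterCZ h c v : iter h C (c *: v) = c *: iter h C v.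
Proof. by elim: h => //= h ->; rewrite /C rhoZ. Qed.

Lemma iterCD h u v : iter h C (u + v) = iter h C u + iter h C v.
Proof. by elim: h => //= h ->; rewrite /C rhoD. Qed.

(** * Action of [P n] and [M] on monomials without [C] *)

Definition P_prod (s : seq 'I_p.+1) (k : 'I_p.+1 -> nat) : V :=
  foldr (fun j : 'I_p.+1 => iter (k j) (rho (P_ p R (p + 1 + j)))) v0 s.

Lemma pbwE h (k : {ffun 'I_p.+1 -> nat}) :
  pbw rho v0 (h, k) = iter h C (P_prod (enum 'I_p.+1) k).
Proof. by []. Qed.

Lemma eq_P_prod s (k k' : 'I_p.+1 -> nat) :
  {in s, k =1 k'} -> P_prod s k = P_prod s k'.
Proof.
elim: s => //= j s IH kk'; rewrite kk' ?mem_head //.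
by rewrite -/(P_prod s k) IH // => i si; rewrite kk' // inE si orbT.
Qed.

Lemma creation_bound (j : 'I_p.+1) : (p + 1 + j < (2 * p).+2)%N.
Proof. by have := ltn_ord j; lia. Qed.

Lemma P_iterP_commute (a : nat) (j : 'I_p.+1) t v :
  (a < (2 * p).+2)%N -> (a + (p + 1 + j) != 2 * p + 1)%N ->
  P a (iter t (P (p + 1 + j)) v) = iter t (P (p + 1 + j)) (P a v).
Proof.
move=> ha /negbTE haj; elim: t => //= t <-.
by rewrite PP ?creation_bound // haj addr0.
Qed.

(** The indices of two creation operators add up to at least [2 * p + 2], beyond [2l], so they
    commute and the new factor can be moved to its place in the product. *)
Lemma P_prod_raise s (k : 'I_p.+1 -> nat) (j : 'I_p.+1) :
  uniq s -> j \in s ->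
  P (p + 1 + j) (P_prod s k) = P_prod s (fun i => k i + (i == j))%N.
Proof.
elim: s => //= i s IH /andP[iNs us]; rewrite inE.
have [-> _ | ji /= js] := eqVneq j i.
  rewrite (addn1 (k i)) [RHS]/= (@eq_P_prod s (fun t => k t + (t == i))%N k) // => t ts.
  by case: eqP => [ti|_]; [rewrite -ti ts in iNs | rewrite addn0].
rewrite P_iterP_commute ?creation_bound //; last by lia.
by rewrite addn0 IH.
Qed.

Lemma M_P_prod s k : M (P_prod s k) = mu *: P_prod s k.
Proof.
elim: s => /= [|j s IH]; first by case: verma => _ [].
by elim: (k j) => //= t IHt; rewrite MP IHt /P rhoZ.
Qed.

(** Leibniz rule: each of the [t] factors contributes the commutator [I_n M], and the central [M]
    acts as [mu]. The truncated [t.-1] is harmless, since at [t = 0] the coefficient vanishes. *)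
Lemma P_iterP_lower (n : nat) (j : 'I_p.+1) t v :
    (n + (p + 1 + j) = 2 * p + 1)%N -> M v = mu *: v ->
  P n (iter t (P (p + 1 + j)) v) = iter t (P (p + 1 + j)) (P n v)
    + (t%:R * (I_ p R n * mu)) *: iter t.-1 (P (p + 1 + j)) v.
Proof.
move=> nj Mv; have hn : (n < (2 * p).+2)%N by lia.
have Mi i : M (iter i (P (p + 1 + j)) v) = mu *: iter i (P (p + 1 + j)) v.
  by elim: i => //= i IHi; rewrite MP IHi /P rhoZ.
elim: t => [|t IH] /=; first by rewrite mul0r scale0r addr0.
rewrite PP ?creation_bound // nj eqxx IH Mi scalerA {1}/P rhoD rhoZ -addrA.
congr (_ + _); case: t {IH} => [|t] /=.
  by rewrite mul0r scale0r add0r mul1r.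
by rewrite -scalerDl -[X in _ + X]mul1r -mulrDl natr1.
Qed.

Lemma P_v0 (n : nat) : (n <= p)%N -> P n v0 = 0.
Proof. by move=> np; case: verma => _ [_ _ ann] _ _; apply/ann/P_in_g_plus. Qed.

(** As [P n] kills [v0] and commutes with every factor except [P (p + 1 + j)], only the derivative
    in that factor survives. *)
Lemma P_prod_lower s k (n : nat) (j : 'I_p.+1) :
    (n + (p + 1 + j) = 2 * p + 1)%N -> uniq s ->
  P n (P_prod s k) = ((j \in s)%:R * ((k j)%:R * (I_ p R n * mu))) *:
    P_prod s (fun i => k i - (i == j))%N.
Proof.
move=> nj; elim: s => [_|i s IH /= /andP[iNs us]].
  by rewrite mul0r scale0r P_v0 //; lia.
rewrite inE; have [ji|ji] := eqVneq j i.
  move: iNs; rewrite -ji => jNs.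
  rewrite P_iterP_lower ?M_P_prod // [P n (P_prod s k)]IH // (negbTE jNs).
  rewrite mul0r scale0r (subn1 (k j)) mul1r.
  rewrite (_ : iter _ _ 0 = 0) ?add0r; last first.
    by elim: (k j) => //= t ->; rewrite /P rho0.
  rewrite (@eq_P_prod s (fun t => k t - (t == j))%N k) // => t ts.
  by case: eqP => [tj|_]; [rewrite -tj ts in jNs | rewrite subn0].
rewrite P_iterP_commute; [|by lia|by rewrite -nj !eqn_add2l val_eqE eq_sym].
rewrite [P n (P_prod s k)]IH //= subn0.
by elim: (k i) => //= t ->; rewrite /P rhoZ.
Qed.

(** * The filtration by powers of [C] *)

Inductive C_below (h : nat) : V -> Prop :=
| C_below0 : C_below h 0
| C_below_cons i c v :
    (i.1 < h)%N -> C_below h v -> C_below h (c *: pbw rho v0 i + v).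

Lemma C_belowD h u v : C_below h u -> C_below h v -> C_below h (u + v).
Proof.
move=> + hv; elim=> [|i c w ih _ IH]; first by rewrite add0r.
by rewrite -addrA; apply: C_below_cons.
Qed.

Lemma C_belowZ h c v : C_below h v -> C_below h (c *: v).
Proof.
elim=> [|i d w ih _ IH]; first by rewrite scaler0; apply: C_below0.
by rewrite scalerDr scalerA; apply: C_below_cons.
Qed.

Lemma C_belowN h v : C_below h v -> C_below h (- v).
Proof. by rewrite -scaleN1r; apply: C_belowZ. Qed.

Lemma C_below_sum h (I : Type) (s : seq I) (Q : pred I) (F : I -> V) :
  (forall i, Q i -> C_below h (F i)) -> C_below h (\sum_(i <- s | Q i) F i).
Proof. by move=> HF; apply: big_ind => //; [apply: C_below0 | apply: C_belowD]. Qed.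

Lemma C_below_pbw h i : (i.1 < h)%N -> C_below h (pbw rho v0 i).
Proof.
move=> ih; rewrite -[pbw _ _ _]scale1r -[_ *: _]addr0.
by apply: C_below_cons => //; apply: C_below0.
Qed.

Lemma C_below_le h h' v : (h <= h')%N -> C_below h v -> C_below h' v.
Proof.
move=> hh'; elim=> [|i c w ih _ IH]; first exact: C_below0.
by apply: C_below_cons => //; apply: leq_trans hh'.
Qed.

Lemma C_below_iterC h t v : C_below h v -> C_below (t + h) (iter t C v).
Proof.
elim=> [|[h' k] c w ih _ IH]; first by rewrite iterC0; apply: C_below0.
rewrite iterCD iterCZ pbwE -iterD -pbwE; apply: C_below_cons => //=.
by rewrite ltn_add2l.
Qed.

Lemma P_prod_C_below k : C_below 1 (P_prod (enum 'I_p.+1) k).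
Proof.
rewrite (@eq_P_prod _ _ [ffun i => k i]) => [|i _]; last by rewrite ffunE.
by rewrite -[P_prod _ _]/(iter 0 C _) -pbwE; apply: C_below_pbw.
Qed.

(** No [C] is created: [P n] differentiates the product if [n <= p] and multiplies it by a further
    factor otherwise. *)
Lemma P_P_prod_C_below (n : nat) k : (n < (2 * p).+2)%N ->
  C_below 1 (P n (P_prod (enum 'I_p.+1) k)).
Proof.
move=> hn; have [np|pn] := leqP n p.
  rewrite (@P_prod_lower _ _ _ (inord (p - n))) ?enum_uniq //.
    exact/C_belowZ/P_prod_C_below.
  by rewrite inordK; lia.
have -> : n = (p + 1 + (inord (n - (p + 1)) : 'I_p.+1))%N.
  by rewrite inordK; lia.
by rewrite P_prod_raise ?enum_uniq ?mem_enum //; apply: P_prod_C_below.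
Qed.

(** Each exchange of [P n] with a [C] costs a multiple of [P n.+1] with that [C] removed. The index
    shift is why the induction on [h] keeps [n] general. *)
Lemma P_iterC (n h : nat) k : (n < (2 * p).+2)%N ->
  C_below h (P n (iter h C (P_prod (enum 'I_p.+1) k))
             - iter h C (P n (P_prod (enum 'I_p.+1) k))).
Proof.
set v := P_prod _ _; elim: h n => [|h IH] n hn /=.
  by rewrite subrr; apply: C_below0.
rewrite PC // addrAC /C -rhoB; apply: C_belowD.
  by apply: (@C_below_iterC h 1); apply: IH.
(* At the last index [n = 2l] the coefficient [2l - n] is zero, which disposes of the dummy value of
   [P_] beyond [2l]. *)
move: hn; rewrite ltnS leq_eqVlt => /predU1P[-> | hn].
  by rewrite -(addn1 (2 * p)) subrr scale0r oppr0; apply: C_below0.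
apply/C_belowN/C_belowZ.
rewrite -[P _ _](subrK (iter h C (P n.+1 v))); apply: C_belowD.
  by apply: (C_below_le (leqnSn h)); apply: IH.
by rewrite -addn1; apply/C_below_iterC/P_P_prod_C_below.
Qed.

Lemma P_C_below (n h : nat) v : (n < (2 * p).+2)%N ->
  C_below h v -> C_below h (P n v).
Proof.
move=> hn; elim=> [|[h' k] c w /= ih _ IH].
  by rewrite /P rho0; apply: C_below0.
rewrite /P rhoD rhoZ; apply: C_belowD => //; apply: C_belowZ.
rewrite pbwE -[rho _ _](subrK (iter h' C (P n (P_prod (enum 'I_p.+1) k)))).
apply: (C_below_le ih); apply: C_belowD.
  by apply: (C_below_le (leqnSn h')); apply: P_iterC.
by rewrite -addn1; apply/C_below_iterC/P_P_prod_C_below.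
Qed.

(** Freeness in [is_verma] concerns lists without repetition, so terms with equal labels have to be
    merged. *)
Lemma C_below_uniq_sum h v : C_below h v ->
  exists s c, [/\ uniq s, all (fun i => i.1 < h)%N s &
                  v = \sum_(i <- s) c i *: pbw rho v0 i].
Proof.
elim=> [|i c w ih _ [s [d [us hs ->]]]].
  by exists [::], (fun=> 0); rewrite big_nil.
pose s' := i :: rem i s; pose di := if i \in s then d i else 0.
exists s', (fun j => if j == i then c + di else d j); split.
- by rewrite /= mem_rem_uniq // inE eqxx rem_uniq.
- rewrite /= ih; apply/allP => j /mem_rem js; exact: (allP hs).
rewrite big_cons eqxx scalerDl -addrA; congr (_ + _).
rewrite [RHS](_ : _ = di *: pbw rho v0 i + \sum_(j <- rem i s) d j *: pbw rho v0 j).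
  rewrite /di; case: ifP => is_; first by rewrite (big_rem i).
  by rewrite scale0r add0r rem_id ?is_.
congr (_ + _); apply: eq_big_seq => j.
by rewrite mem_rem_uniq // inE => /andP[/negbTE ->].
Qed.

(** Monomials with exactly [h] factors [C] are distinct from those with fewer, so the two sides form
    one relation between distinct basis vectors. *)
Lemma pbw_free_mod_C_below h (I : finType) (Q : pred I) (c : I -> R)
    (k : I -> {ffun 'I_p.+1 -> nat}) :
  {in Q &, injective k} ->
  C_below h (\sum_(x | Q x) c x *: pbw rho v0 (h, k x)) ->
  forall x, Q x -> c x = 0.
Proof.
move=> k_inj /C_below_uniq_sum[s [d [us hs eq_sum]]] x Qx.
case: verma => _ _ _ free.
pose e := [seq (h, k y) | y <- enum Q].
(* Coefficients of that relation. By injectivity of [k] the inner sum has at most one term, which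
   inverts [k] without choosing a preimage. *)
pose f i := if i.1 == h
  then - (\sum_(y | Q y && (k y == i.2)) c y) else d i : R.
have fk y : Q y -> f (h, k y) = - c y.
  move=> Qy; rewrite /f /= eqxx (big_pred1 y) // => z /=.
  apply/andP/eqP => [[Qz /eqP]|-> //]; exact: k_inj.
have ue : uniq (e ++ s).
  rewrite cat_uniq us map_inj_in_uniq ?enum_uniq ?andbT => /=; last first.
    by move=> y z; rewrite !mem_enum => Qy Qz [/k_inj->].
  apply/hasPn => i /(allP hs) ih; apply/negP => /mapP[y _ iy].
  by rewrite iy ltnn in ih.
have := free (e ++ s) f ue; rewrite big_cat /= big_map big_enum /=.
have -> : \sum_(i <- s) f i *: pbw rho v0 i = \sum_(i <- s) d i *: pbw rho v0 i.
  apply: eq_big_seq => i /(allP hs) ih.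
  by rewrite /f (ltn_eqF ih).
rewrite -eq_sum -big_split big1 => [/(_ erefl) fz|y Qy]; last first.
  by rewrite fk //= scaleNr addNr.
apply: oppr_inj; rewrite oppr0 -fk // fz // mem_cat map_f ?mem_enum //.
Qed.

(** * Labels of a fixed level and vanishing of coefficients *)

Section Level.
Variable m : nat.

Lemma full_exponents_inj (x y : label p m) :
  (val x).1 = (val y).1 -> full_exponents x =1 full_exponents y -> x = y.
Proof.
case: x y => [[h k] hx] [[h' k'] hy] /= hh' kk'; apply: val_inj => /=.
congr (_, _) => //; apply/ffunP => i; apply: val_inj.
by have := kk' (lift ord0 i); rewrite /full_exponents liftK.
Qed.

(** The bound built into [label] makes the truncated subtraction defining [k_0] exact, so [k_0 = 0]
    forces the partial level [2h] to be all of [m]. *)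
Lemma zero_exponents_level (x : label p m) :
  full_exponents x =1 (fun=> 0%N) -> m = (2 * (val x).1)%N.
Proof.
case: x => [[h k] /= hx] k0.
have k0' i : k i = 0%N :> nat.
  by have := k0 (lift ord0 i); rewrite /full_exponents liftK.
have := k0 ord0; rewrite /full_exponents unlift_none /=.
move: (hx); rewrite /partial_level /= big1 => [|i _]; last by rewrite k0' muln0.
by lia.
Qed.

Lemma zero_exponents_unique (x y : label p m) :
  full_exponents x =1 (fun=> 0%N) -> full_exponents y =1 (fun=> 0%N) -> x = y.
Proof.
move=> kx ky; apply: full_exponents_inj => [|i]; last by rewrite kx ky.
apply: val_inj; apply/eqP; rewrite -(eqn_pmul2l (isT : (0 < 2)%N)); apply/eqP.
exact: etrans (esym (zero_exponents_level kx)) (zero_exponents_level ky).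
Qed.

Lemma ketE (x : label p m) :
  ket rho v0 x = iter (val x).1 C (P_prod (enum 'I_p.+1) (full_exponents x)).
Proof. by []. Qed.

Lemma ket_pbw (x : label p m) :
  ket rho v0 x = pbw rho v0 ((val x).1 : nat, [ffun i => full_exponents x i]).
Proof.
by rewrite pbwE ketE; congr iter; apply: eq_P_prod => i _; rewrite ffunE.
Qed.

(** Modulo lower powers of [C], a suitable [P n] differentiates the degree [d] part in
    [P (p + 1 + j)]. Distinct monomials containing that factor have distinct derivatives, so
    freeness applies. *)
Lemma annihilated_top_degree (a : label p m -> R) (d : nat) :
  mu != 0 ->
  (forall n, (n <= p)%N -> P n (ket_sum rho v0 a) = 0) ->
  (forall x : label p m, (d < (val x).1)%N -> a x = 0) ->
  forall (x : label p m) j,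
    (val x).1 = d :> nat -> (0 < full_exponents x j)%N -> a x = 0.
Proof.
move=> mu0 ann above x j xd kj.
(* This is [2l - (p + 1 + j)], the index paired with the chosen factor by the bracket. *)
pose n := (p - j)%N; have jp : (j <= p)%N by rewrite -ltnS.
have hn : (n < (2 * p).+2)%N by rewrite /n; lia.
have nj : (n + (p + 1 + j) = 2 * p + 1)%N by rewrite /n; lia.
pose Q := [pred y : label p m | (val y).1 == d :> nat].
pose Qj := [pred y : label p m | Q y & (0 < full_exponents y j)%N].
(* Exponents after differentiation; [k] is injective on [Qj] because there the exponent at [j] is
   positive. *)
pose k (y : label p m) := [ffun i => full_exponents y i - (i == j)]%N.
pose c y := a y * ((full_exponents y j)%:R * (I_ p R n * mu)).
suff /eqP : c x = 0.
  rewrite mulf_eq0 => /orP[/eqP //|].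
  by rewrite (negbTE (mulf_neq0 _ (mulf_neq0 (I_neq0 p R n) mu0))) // pnatr_eq0 -lt0n.
have Qjx : Qj x by rewrite inE /= xd eqxx.
apply: (@pbw_free_mod_C_below d _ Qj c k) Qjx => [y z|].
  rewrite !inE => /andP[/eqP yd yj] /andP[/eqP zd zj] /ffunP kyz.
  apply: full_exponents_inj => [|i]; first by apply: val_inj; rewrite /= yd zd.
  have := kyz i; rewrite !ffunE; case: eqP => [->|_]; last by rewrite !subn0.
  by move: yj zj; lia.
have -> : \sum_(y | Qj y) c y *: pbw rho v0 (d, k y) =
    \sum_(y | Q y) a y *: iter d C (P n (P_prod (enum 'I_p.+1) (full_exponents y))).
  rewrite [RHS](bigID (fun y => 0 < full_exponents y j)%N) /=.
  rewrite [X in _ + X]big1 ?addr0 => [|y /andP[_]]; last first.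
    rewrite -eqn0Ngt => /eqP yj; rewrite (P_prod_lower _ nj) ?enum_uniq //.
    by rewrite yj mul0r mulr0 scale0r iterC0 scaler0.
  apply: eq_bigr => y _; rewrite (P_prod_lower _ nj) ?enum_uniq // mem_enum.
  rewrite mul1r iterCZ scalerA pbwE; congr (_ *: iter _ _ _).
  by apply: eq_P_prod => i _; rewrite ffunE.
have := ann n (leq_subr _ _); rewrite /ket_sum /P rho_sum (bigID Q) /= => /eqP.
rewrite addr_eq0 => /eqP sumQ.
(* Compare with the exact action on the degree [d] terms: it is minus the action on the other terms,
   hence of lower degree, and it differs from the derivative by the lower terms of [P_iterC]. *)
rewrite -[X in C_below _ X](subKr (\sum_(y | Q y) rho (P_ p R n) (a y *: ket rho v0 y))).
apply: C_belowD.
  rewrite sumQ; apply/C_belowN/C_below_sum => y /eqP yd.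
  have [yd'|dy] := ltnP (val y).1 d.
    by apply: P_C_below => //; apply: C_belowZ; rewrite ket_pbw; apply: C_below_pbw.
  rewrite above ?scale0r ?rho0; first exact: C_below0.
  by rewrite ltn_neqAle eq_sym dy andbT; apply/eqP.
rewrite -sumrB; apply/C_belowN/C_below_sum => y /eqP yd.
rewrite rhoZ -scalerBr; apply: C_belowZ.
by rewrite -yd; apply: P_iterC.
Qed.

Lemma annihilated_eq0 (a : label p m -> R) :
    mu != 0 ->
    (forall n, (n <= p)%N -> P n (ket_sum rho v0 a) = 0) ->
    (forall x : label p m, full_exponents x =1 (fun=> 0%N) -> a x = 0) ->
  forall x, a x = 0.
Proof.
move=> mu0 ann a0.
(* Downward induction on the power of [C]: [d] measures the descent from the bound [m] in the type
   of labels, and [d = m + 1] covers every label. *)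
have above d : forall x : label p m, (m < (val x).1 + d)%N -> a x = 0.
  elim: d => [x|d IH x].
    by rewrite addn0 ltnNge -ltnS ltn_ord.
  rewrite addnS ltnS leq_eqVlt => /orP[/eqP mxd|]; last exact: IH.
  have [/forallP x0|] := boolP [forall j, full_exponents x j == 0%N].
    by apply: a0 => j; apply/eqP.
  rewrite negb_forall => /existsP[j]; rewrite -lt0n.
  apply: (annihilated_top_degree mu0 ann) erefl => y xy.
  by apply: IH; rewrite [X in (X < _)%N]mxd ltn_add2r.
by move=> x; apply: (above m.+1); rewrite addnS ltnS leq_addl.
Qed.

Lemma singular_zero_exponents (a : label p m -> R) :
  mu != 0 -> is_singular rho v0 m (ket_sum rho v0 a) ->
  exists2 x : label p m, full_exponents x =1 (fun=> 0%N) & a x != 0.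
Proof.
move=> mu0 [_ nz ann].
have [/existsP[x /andP[/forallP x0 ax]]|] :=
    boolP [exists x : label p m, [forall j, full_exponents x j == 0%N] && (a x != 0)].
  by exists x => // j; apply/eqP.
rewrite negb_exists => /forallP a0; case/negP: nz; apply/eqP.
rewrite /ket_sum big1 // => x _; rewrite (annihilated_eq0 mu0) ?scale0r //.
  by move=> n np; apply/ann/P_in_g_plus.
move=> y y0; have := a0 y; rewrite negb_and negbK => /orP[|/eqP //].
by case/negP; apply/forallP => j; rewrite y0.
Qed.

Lemma ket_sumP c (a b : label p m -> R) :
  ket_sum rho v0 (fun x => c * a x + b x) =
  c *: ket_sum rho v0 a + ket_sum rho v0 b.
Proof.
rewrite /ket_sum scaler_sumr -big_split; apply: eq_bigr => x _ /=.
by rewrite scalerDl scalerA.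
Qed.

End Level.
End Verma.

(** * Parity of the level and uniqueness of the coefficients *)

Theorem theorem4 (p : nat) (R : realType) (delta mu : R)
    (V : lmodType R) (rho : cga p R -> V -> V) (v0 : V) (m : nat) :
  mu != 0 ->
  is_verma rho v0 delta mu ->
  (1 <= m)%N ->
  forall a : label p m -> R,
    is_singular rho v0 m (ket_sum rho v0 a) ->
    ~~ odd m /\
    forall b : label p m -> R,
      is_singular rho v0 m (ket_sum rho v0 b) ->
      exists2 c : R, c != 0 & forall x : label p m, b x = c * a x.
Proof.
move=> mu0 verma _ a sa.
have [x x0 ax] := singular_zero_exponents verma mu0 sa.
split; first by rewrite (zero_exponents_level x0) oddM.
move=> b sb; have [y y0 bx] := singular_zero_exponents verma mu0 sb.
move: bx; rewrite -(zero_exponents_unique x0 y0) => bx.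
(* This ratio makes [b - c * a] vanish at the only label without factors [P], so [annihilated_eq0]
   applies to the difference. *)
exists (b x / a x); first by rewrite mulf_neq0 ?invr_eq0.
move=> z; apply/eqP; rewrite -subr_eq0 addrC -mulNr; apply/eqP.
move: z; apply: (annihilated_eq0 verma mu0) => [n np|z z0].
  have g := P_in_g_plus R np; case: sa sb => _ _ sa [_ _ sb].
  by rewrite ket_sumP (rhoP verma) sa // sb // scaler0 addr0.
by rewrite (zero_exponents_unique z0 x0) mulNr divfK // addNr.
Qed.
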